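(* Let $d\ge 1$, let $\gamma,p\in\mathbb{R}$ with $\gamma+2p\ge 1$, and let $0<c_1\le c_2<\infty$. Suppose that $K:\mathbb{R}^d_*\times\mathbb{R}^d_*\to\mathbb{R}_+$ is continuous and satisfies $$c_1(|x|+|y|)^{\gamma}\,\Phi\!\left(\tfrac{|x|}{|x|+|y|}\right)\le K(x,y)\le c_2(|x|+|y|)^{\gamma}\,\Phi\!\left(\tfrac{|x|}{|x|+|y|}\right),\qquad x,y\in\mathbb{R}^d_*,$$ where $\Phi(s)=s^{-p}(1-s)^{-p}$ for $0<s<1$. Then there are no non-trivial constant flux solutions with kernel $K$ and parameters $(\gamma,p)$.
   Context: Notation: $\mathbb{R}_+=[0,\infty)$, $O=(0,\dots,0)$, $\mathbb{R}^d_*=\mathbb{R}_+^d\setminus\{O\}$, $\mathbb{R}_*=(0,\infty)$, $|x|=\sum_{j=1}^d x_j$ (the $\ell^1$-norm). $\mathcal{M}_+(X)$ denotes the non-negative Radon measures on $X$ (not necessarily bounded). $C^1_c(\mathbb{R}^d_* )$ denotes the $C^1$ functions with compact support in $\mathbb{R}^d_*$. $\Delta^{d-1}=\{\theta\in\mathbb{R}^d_*:|\theta|=1\}$ with surface area element $d\tau(\theta)$. Definition (constant flux solution with kernel $K$, parameters $(\gamma,p)$). A measure $f\in\mathcal{M}_+(\mathbb{R}^d_* )$ is a stationary solution (without source) if $$\int_{\{|x|\ge1\}}|x|^{\gamma+p}f(dx)+\int_{\{|x|<1\}}|x|^{1-p}f(dx)<\infty$$ and for every $\varphi\in C^1_c(\mathbb{R}^d_*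 )$ $$0=\frac12\int_{\mathbb{R}^d_*}\int_{\mathbb{R}^d_*}K(x,y)\,[\varphi(x+y)-\varphi(x)-\varphi(y)]\,f(dx)f(dy).$$ Its total flux across $\{|x|=R\}$ is the vector $A(R)$, $R>0$, with components $$A_j(R)=\frac1d\int_{(0,R]\times\Delta^{d-1}}dr\,d\tau(\theta)\int_{(R-r,\infty)\times\Delta^{d-1}}d\rho\,d\tau(\sigma)\;r^d\rho^{d-1}F(r,\theta)F(\rho,\sigma)\,\theta_j\,K(r\theta,\rho\sigma),$$ where $F\in\mathcal{M}_+(\mathbb{R}_*\times\Delta^{d-1})$ is defined by $\int\psi(r,\theta)\frac{r^{d-1}}{\sqrt d}F(r,\theta)\,dr\,d\tau(\theta)=\int\psi(|x|,x/|x|)f(dx)$ for all $\psi\in C_c(\mathbb{R}_*\times\Delta^{d-1})$. Equivalently, $A_j(R)=\iint_{\{|x|\le R,\ |x|+|y|>R\}}x_jK(x,y)f(dx)f(dy)$. The measure $f$ is a non-trivial constant flux solution if it is a stationary solution and there is $J_0\in\mathbb{R}_+^d\setminus\{O\}$ such that $A(R)=J_0$ for all $R>0$. *)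

(* Defs.v *)
From HB Require Import structures.
From mathcomp Require Import all_boot all_order all_algebra.
From mathcomp Require Import all_classical all_reals all_analysis.
From mathcomp Require Import measurable_realfun.

Set Implicit Arguments.
Unset Strict Implicit.
Unset Printing Implicit Defensive.

Import Order.TTheory GRing.Theory Num.Theory.
Import numFieldNormedType.Exports.

Local Open Scope classical_set_scope.
Local Open Scope ring_scope.

(* R^d equipped with its Borel sigma-algebra. *)
Notation borelRd R d := (g_sigma_algebraType (@open 'rV[R]_d)).

Section geometry.
Variables (R : realType) (d : nat).

Definition l1norm (x : 'rV[R]_d) : R := \sum_(j < d) `|x 0 j|.

Definition Rdstar : set 'rV[R]_d :=
  [set x : 'rV[R]_d | (forall j, 0 <= x 0 j) /\ x != 0].

Definition simplex : set 'rV[R]_d :=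
  [set x : 'rV[R]_d | Rdstar x /\ l1norm x = 1].

Definition polar_space : set (measurableTypeR R * borelRd R d) :=
  [set u | 0 < u.1 /\ simplex u.2].

(* x |-> (|x|, x / |x|); its value at the origin is irrelevant. *)
Definition polar (x : borelRd R d) : measurableTypeR R * borelRd R d :=
  (l1norm x, (l1norm x)^-1 *: (x : 'rV[R]_d)).

Lemma continuous_l1norm : continuous l1norm.
Proof.
apply: continuous_big => [|j _ x]; first exact: add_continuous.
apply: (@continuous_comp _ _ _ (fun y : 'rV[R]_d => y 0 j) Num.norm).
  exact: coord_continuous.
exact: norm_continuous.
Qed.

Lemma l1norm_eq0 x : (l1norm x == 0) = (x == 0).
Proof.
rewrite psumr_eq0//; apply/allP/eqP => [x0|-> j _]; last first.
  by rewrite /= mxE normr0.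
apply/rowP => j; rewrite mxE; apply/eqP; rewrite -normr_eq0.
exact: (x0 j (mem_index_enum j)).
Qed.

Lemma open_measurable_borelRd (A : set 'rV[R]_d) :
  open A -> measurable (A : set (borelRd R d)).
Proof. by move=> oA; exact: sub_sigma_algebra. Qed.

Lemma measurable_l1norm :
  measurable_fun [set: borelRd R d] (l1norm : borelRd R d -> R).
Proof.
apply: (measurability _ (RGenOpens.measurableE R)).
move=> _ [_ [a [b ->] <-]]; rewrite setTI; apply: open_measurable_borelRd.
apply: open_comp; last exact: interval_open.
by move=> x _; exact: continuous_l1norm.
Qed.

Lemma measurable_polar : measurable_fun [set: borelRd R d] polar.
Proof.
apply: measurable_fun_pair => /=; first exact: measurable_l1norm.
refine (@measurability _ _ (borelRd R d) (borelRd R d) setT _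
  (@open 'rV[R]_d) erefl _) => _ [A oA <-].
rewrite setTI.
set g := fun x => _.
have -> : g @^-1` A =
  (~` [set 0] `&` g @^-1` A) `|` ([set 0] `&` g @^-1` A).
  by rewrite -setIUl setUC setUv setTI.
have oC : open (~` [set (0 : 'rV[R]_d)]).
  apply/closed_openC/accessible_closed_set1/hausdorff_accessible.
  exact: norm_hausdorff.
apply: measurableU.
  apply: open_measurable_borelRd.
  rewrite openE => x [x0 Ax]; apply: filterI; first exact:
    (open_nbhs_nbhs (conj oC x0)).
  have cg : {for x, continuous (fun y : 'rV[R]_d => (l1norm y)^-1 *: y)}.
    apply: (@cvgZ _ _ _ (nbhs x) _ (fun y => (l1norm y)^-1) id).
      apply: (@cvgV _ _ (nbhs x) _ l1norm); last exact: continuous_l1norm.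
      by rewrite l1norm_eq0; apply/eqP.
    exact: cvg_id.
  by apply: cg; exact: (open_nbhs_nbhs (conj oA Ax)).
have [A0|A0] := pselect (A (g 0)).
  rewrite (_ : _ `&` _ = [set 0]).
    rewrite -[X in measurable X]setCK; apply: measurableC.
    exact: open_measurable_borelRd.
  by apply/seteqP; split => [x []//|x ->].
by rewrite (_ : _ `&` _ = set0)//; apply/seteqP; split => // x [->].
Qed.

End geometry.

Arguments Rdstar : clear implicits.
Arguments simplex : clear implicits.
Arguments polar_space : clear implicits.

(* polar_measure f is the measure F on (0, +oo) x simplex, written
   F(r, theta) dr dtau(theta), for which r^(d-1) / sqrt d F is the image of f
   under polar (see polar_measureP); it is obtained as the image under polar of
   the measure sqrt d |x|^(1-d) f(dx). *)
Section polar_measure.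
Variables (R : realType) (d : nat) (f : {measure set (borelRd R d) -> \bar R}).
Local Open Scope ereal_scope.

Definition weight (x : borelRd R d) : R :=
  (Num.sqrt d%:R * (l1norm x) `^ (1 - d%:R))%R.

Let weight_ge0 x : (0 <= weight x)%R.
Proof. by rewrite mulr_ge0 ?sqrtr_ge0 ?powR_ge0. Qed.

Let measurable_weight : measurable_fun setT weight.
Proof.
apply: measurable_funM => //; apply: (measurableT_comp (measurable_powR _)).
exact: measurable_l1norm.
Qed.

Definition weighted (B : set (borelRd R d)) : \bar R :=
  \int[f]_(x in B) (weight x)%:E.

Let weighted0 : weighted set0 = 0.
Proof. exact: integral_set0. Qed.

Let weighted_ge0 B : 0 <= weighted B.
Proof. by apply: integral_ge0 => x _; rewrite lee_fin. Qed.

Let weighted_sigma_additive : semi_sigma_additive weighted.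
Proof.
apply: semi_sigma_additive_nng_induced => [|x]; last by rewrite lee_fin.
exact/measurable_EFinP.
Qed.

HB.instance Definition _ := isMeasure.Build _ _ _
  weighted weighted0 weighted_ge0 weighted_sigma_additive.

Definition polar_measure : set (measurableTypeR R * borelRd R d) -> \bar R :=
  pushforward weighted (@polar R d).

HB.instance Definition _ := Measure.copy polar_measure
  (measure_function_pushforward__canonical__measure_function_Measure
     weighted (@measurable_polar R d)).

Import HBNNSimple.

Lemma ge0_integral_weighted (D : set (borelRd R d)) (h : borelRd R d -> \bar R) :
  measurable D -> measurable_fun D h -> (forall x, D x -> 0 <= h x) ->
  \int[weighted]_(x in D) h x = \int[f]_(x in D) (h x * (weight x)%:E).
Proof.
move=> mD mh h0; pose h_ := nnsfun_approx mD mh.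
have mw : measurable_fun setT (fun x => (weight x)%:E).
  exact/measurable_EFinP.
transitivity (limn (fun n => \int[weighted]_(x in D) (h_ n x)%:E)).
  rewrite -monotone_convergence//=.
  - apply: eq_integral => x /[!inE] xD; apply/esym/cvg_lim => //=.
    exact: cvg_nnsfun_approx.
  - by move=> n; apply: measurableT_comp => //; exact: measurable_funTS.
  - by move=> n x _; rewrite lee_fin.
  - by move=> x _ a b ab; rewrite lee_fin//; exact/lefP/nd_nnsfun_approx.
transitivity (limn (fun n => \int[f]_(x in D) ((h_ n x)%:E * (weight x)%:E))).
  congr (limn _); apply/funext => n.
  under [LHS]eq_integral do rewrite fimfunE -fsumEFin//.
  rewrite [LHS]ge0_integral_fsum//; last 2 first.
  - by move=> r; exact/measurable_EFinP/measurableT_comp.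
  - by move=> m x _; rewrite EFinM nnfun_muleindic_ge0.
  under [RHS]eq_integral.
    move=> x xD; rewrite fimfunE -fsumEFin// ge0_mule_fsuml; last first.
      by move=> r; rewrite EFinM nnfun_muleindic_ge0.
    over.
  rewrite [RHS]ge0_integral_fsum//; last 2 first.
  - move=> r; apply: emeasurable_funM; last exact: measurable_funTS.
    exact/measurable_EFinP/measurableT_comp.
  - move=> m x _; apply: mule_ge0; last by rewrite lee_fin.
    by rewrite EFinM nnfun_muleindic_ge0.
  apply: eq_fsbigr => r /[!inE] -[y _ ry].
  have r0 : (0 <= r)%R by rewrite -ry.
  have mr : measurable (h_ n @^-1` [set r]) by [].
  rewrite integralZl_indic_nnsfun// integral_indic//.
  under [RHS]eq_integral do rewrite EFinM -muleA.
  rewrite ge0_integralZl//; last 2 first.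
  - apply: emeasurable_funM; last exact: measurable_funTS.
    exact/measurable_EFinP.
  - by move=> x _; rewrite mule_ge0 ?lee_fin.
  congr (_ * _).
  transitivity (\int[f]_(x in h_ n @^-1` [set r] `&` D) (weight x)%:E).
    by [].
  rewrite integral_mkcondl epatch_indic.
  by apply: eq_integral => x _; rewrite muleC.
rewrite -monotone_convergence//=.
- apply: eq_integral => x /[!inE] xD; apply/cvg_lim => //=.
  apply: cvgeMr => //; exact: cvg_nnsfun_approx.
- move=> n; apply: emeasurable_funM; last exact: measurable_funTS.
  by apply: measurableT_comp => //; exact: measurable_funTS.
- by move=> n x _; rewrite mule_ge0 ?lee_fin.
- move=> x _ a b ab; apply: lee_wpmul2r; rewrite lee_fin//.
  exact/lefP/nd_nnsfun_approx.
Qed.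

Lemma polar_preimage :
  @polar R d @^-1` (polar_space R d) = Rdstar R d.
Proof.
apply/seteqP; split => [x /= [r0 [[x0 _] _]]|x [x0 xn0]].
  split=> [j|]; last first.
    have : (l1norm x != 0)%R by rewrite gt_eqF.
    by rewrite l1norm_eq0.
  by move: (x0 j); rewrite mxE pmulr_rge0 ?invr_gt0.
have r0 : (0 < l1norm x)%R.
  by rewrite lt_def l1norm_eq0 xn0 sumr_ge0.
split => //; split; first split.
- by move=> j; rewrite mxE mulr_ge0 ?invr_ge0 ?(ltW r0).
- by rewrite scaler_eq0 invr_eq0 gt_eqF.
rewrite /l1norm/=; under eq_bigr do rewrite mxE normrM.
by rewrite -mulr_sumr normfV (gtr0_norm r0) mulVf ?gt_eqF.
Qed.

Lemma closed_borelRd (A : set 'rV[R]_d) :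
  closed A -> measurable (A : set (borelRd R d)).
Proof.
move=> cA; rewrite -[X in measurable X]setCK; apply: measurableC.
by apply: open_measurable_borelRd; exact: closed_openC.
Qed.

Lemma measurable_simplex : measurable (simplex R d : set (borelRd R d)).
Proof.
have -> : simplex R d =
    (\bigcap_(j in [set: 'I_d]) [set x : 'rV[R]_d | (0 <= x 0%R j)%R]) `&`
    [set x : 'rV[R]_d | l1norm x = 1%R].
  apply/seteqP; split => [x [[x0 _] x1]|x [x0 x1]].
    by split => // j _; exact: x0.
  split => //; split => [j|]; first exact: x0.
  by have := oner_neq0 R; rewrite -x1 l1norm_eq0.
apply: closed_borelRd; apply: closedI.
  apply: closed_bigI => j _.
  apply: (@closed_comp _ _ (fun x : 'rV[R]_d => x 0%R j) [set y | (0 <= y)%R]).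
    by move=> x _; exact: coord_continuous.
  exact: closed_ge.
apply: (@closed_comp _ _ (@l1norm R d) [set y | y = 1%R]).
  by move=> x _; exact: continuous_l1norm.
exact: closed_eq.
Qed.

Lemma measurable_polar_space :
  measurable (polar_space R d).
Proof.
rewrite (_ : polar_space R d = `]0%R, +oo[%classic `*` simplex R d).
  by apply: measurableX => //; exact: measurable_simplex.
by apply/seteqP; split => u /=; rewrite in_itv/= andbT.
Qed.

Let polar_measureP_ge0 (psi : measurableTypeR R * borelRd R d -> \bar R) :
  (0 < d)%N ->
  let D := polar_space R d in
  measurable_fun D psi -> (forall u, D u -> 0 <= psi u) ->
  \int[polar_measure]_(u in D) (psi u * (u.1 ^+ d.-1 / Num.sqrt d%:R)%:E) =
  \int[f]_(x in Rdstar R d) psi (polar x).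
Proof.
move=> d0 D mpsi psi0; have mD : measurable D := measurable_polar_space.
have mk : measurable_fun D
    (fun u : measurableTypeR R * borelRd R d =>
       (u.1 ^+ d.-1 / Num.sqrt d%:R)%:E).
  apply/measurable_EFinP; apply: measurable_funM => //.
  by apply: measurable_funX; apply: measurable_funTS; exact: measurable_fst.
have mg := emeasurable_funM mpsi mk.
have g0 u : D u -> 0 <= psi u * (u.1 ^+ d.-1 / Num.sqrt d%:R)%:E.
  move=> Du; rewrite mule_ge0 ?psi0// lee_fin divr_ge0 ?sqrtr_ge0//.
  by rewrite exprn_ge0// ltW//; case: Du.
rewrite /polar_measure ge0_integral_pushforward//; last 2 first.
- exact: measurable_polar.
- by move=> u /[!inE]; exact: g0.
have mP : measurable (@polar R d @^-1` D).
  by rewrite -[X in measurable X]setTI; exact: measurable_polar.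
rewrite ge0_integral_weighted//; last 2 first.
- apply: (measurable_comp mD) => //; first by move=> _ [x Dx <-].
  by apply: measurable_funTS; exact: measurable_polar.
- by move=> x; exact: g0.
rewrite -polar_preimage; apply: eq_integral => x /[!inE] -[/= r0 _].
rewrite -muleA -EFinM /weight.
rewrite (_ : 1 - d%:R = - (d.-1)%:R)%R; last first.
  by rewrite -{1}(prednK d0) mulrS opprD addrA subrr sub0r.
rewrite powRN powR_mulrn ?(ltW r0)// mulrA mulfVK; last first.
  by rewrite gt_eqF// sqrtr_gt0 ltr0n.
by rewrite divff ?mule1// expf_neq0// gt_eqF.
Qed.

Lemma polar_measureP (psi : measurableTypeR R * borelRd R d -> R) :
  (0 < d)%N ->
  let D := polar_space R d in
  measurable_fun D psi ->
  \int[polar_measure]_(u in D) (psi u * (u.1 ^+ d.-1 / Num.sqrt d%:R))%:E =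
  \int[f]_(x in Rdstar R d) (psi (polar x))%:E.
Proof.
move=> d0 D mpsi; have mE : measurable_fun D (EFin \o psi).
  exact/measurable_EFinP.
have k0 u : D u -> (0 <= u.1 ^+ d.-1 / Num.sqrt d%:R)%R.
  by case=> r0 _; rewrite divr_ge0 ?sqrtr_ge0// exprn_ge0// ltW.
rewrite [LHS]integralE [RHS]integralE; congr (_ - _).
  transitivity (\int[f]_(x in Rdstar R d) ((EFin \o psi)^\+ (polar x))).
    rewrite -(polar_measureP_ge0 d0 (measurable_funepos mE))//.
    apply: eq_integral => u /[!inE] /k0 ku.
    by rewrite !funeposE /= EFinM maxe_pMl ?mul0e ?lee_fin.
  by apply: eq_integral => x _; rewrite !funeposE.
transitivity (\int[f]_(x in Rdstar R d) ((EFin \o psi)^\- (polar x))).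
  rewrite -(polar_measureP_ge0 d0 (measurable_funeneg mE))//.
  apply: eq_integral => u /[!inE] /k0 ku.
  by rewrite !funenegE /= maxe_pMl ?lee_fin// mul0e -EFinM mulNr.
by apply: eq_integral => x _; rewrite !funenegE.
Qed.
End polar_measure.

Section model.
Variables (R : realType) (d : nat).
Local Notation V := 'rV[R]_d.
Local Notation Rdstar := (Rdstar R d).

(* A measure on Rdstar is encoded as a Borel measure on R^d that does not
   charge the complement of Rdstar. *)
Definition radon_Rdstar (f : {measure set (borelRd R d) -> \bar R}) : Prop :=
  [/\ f (~` Rdstar) = 0%E,
      forall C : set V, compact C -> C `<=` Rdstar -> (f C < +oo)%E &
      forall B : set (borelRd R d), measurable B -> B `<=` Rdstar ->
        f B = ereal_sup
          [set f C | C in [set C : set V | compact C /\ C `<=` B]]].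

(* Rdstar is not open: it contains the boundary faces of the orthant. C^1 on
   Rdstar means C^1 on an open neighbourhood of Rdstar in R^d. The values of
   phi outside Rdstar play no role, so phi is a total function. *)
Definition C1c_Rdstar (phi : V -> R) : Prop :=
  (exists U : set V,
     [/\ open U, Rdstar `<=` U,
         forall x : V, U x -> differentiable phi x &
         forall v x : V, U x -> {for x, continuous ('D_v phi)}]) /\
  (exists C : set V,
     [/\ compact C, C `<=` Rdstar &
         forall x : V, Rdstar x -> ~ C x -> phi x = 0]).

Definition Phi (p s : R) : R := s `^ (- p) * (1 - s) `^ (- p).

Variables (K : V -> V -> R) (gam p : R).
Variable f : {measure set (borelRd R d) -> \bar R}.

Definition stationary_solution : Prop :=
  [/\ radon_Rdstar f,
      (\int[f]_(x in Rdstar `&` [set x : V | (1 <= l1norm x)%R])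
          (l1norm x `^ (gam + p))%:E +
       \int[f]_(x in Rdstar `&` [set x : V | (l1norm x < 1)%R])
          (l1norm x `^ (1 - p))%:E < +oo)%E &
      forall phi : V -> R, C1c_Rdstar phi ->
        (0 = (2^-1)%:E *
           \int[f]_(y in Rdstar) \int[f]_(x in Rdstar)
             (K x y * (phi ((x : V) + (y : V)) - phi x - phi y))%:E)%E].

Definition flux (rad : R) (j : 'I_d) : \bar R :=
  ((d%:R^-1)%:E *
   \int[polar_measure f]_(u in `]0%R, rad]%classic `*` simplex R d)
     \int[polar_measure f]_(v in `](rad - u.1)%R, +oo[%classic `*` simplex R d)
       (u.1 ^+ d * v.1 ^+ d.-1 * (u.2 : V) ord0 j *
        K (u.1 *: (u.2 : V)) (v.1 *: (v.2 : V)))%:E)%E.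

Definition nontrivial_constant_flux_solution : Prop :=
  stationary_solution /\
  exists J0 : V, Rdstar J0 /\
    forall (rad : R) (j : 'I_d), 0 < rad -> flux rad j = (J0 ord0 j)%:E.

End model.

(* Main.v *)
(* Only the upper bound on K matters. Write q = gam + 2p >= 1 and, in polar
   coordinates, nu = r^(d-1-p) F. The flux across {|x| = s} is at most a
   constant times
     \iint_{r <= s < r + r'} r (r + r')^q nu(dr) nu(dr').
   Pointwise in s this is hard to control, since nu may be infinite near r' = 0,
   where only \int r' dnu converges. But for fixed r, r' the set of s with
   r <= s < r + r' has length r', so averaging over s in [2N, 4N] brings the
   missing factor r' back and bounds the average by a constant times
     (\int r dnu) (\int_{r >= N} r^q dnu).
   The moment condition makes the first factor finite (this is where q >= 1
   enters) and the second tend to 0, so a flux constant in s vanishes. *)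
Require Import Defs.
From HB Require Import structures.
From mathcomp Require Import all_boot all_order all_algebra.
From mathcomp Require Import all_classical all_reals all_analysis.
From mathcomp Require Import measurable_realfun ring lra.

Set Implicit Arguments.
Unset Strict Implicit.
Unset Printing Implicit Defensive.

Import Order.TTheory GRing.Theory Num.Theory.
Import numFieldNormedType.Exports.
Local Open Scope classical_set_scope.
Local Open Scope ring_scope.

(** * Integration tools: monotonicity and a triple Tonelli exchange *)

(* Unlike ge0_le_integral, no measurability is required of f and g, so that the
   flux integrand can be bounded without proving K measurable. *)
Lemma ge0_le_integral_unmeasurable (R : realType) (disp : measure_display)
    (T : measurableType disp) (mu : {measure set T -> \bar R}) (D E : set T)
    (f g : T -> \bar R) :
  (forall x, D x -> 0 <= f x)%E -> (forall x, E x -> 0 <= g x)%E ->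
  D `<=` E -> (forall x, D x -> f x <= g x)%E ->
  (\int[mu]_(x in D) f x <= \int[mu]_(x in E) g x)%E.
Proof.
move=> f0 g0 DE fg; rewrite !ge0_integralE//.
apply: ge_ereal_sup => _ [h /= hf <-]; apply: ereal_sup_ubound.
exists h => // x.
apply: (le_trans (hf x)); rewrite /patch; case: ifPn => [/set_mem xD|_].
  by rewrite mem_set ?fg//; exact: DE.
by case: ifPn => // /set_mem; exact: g0.
Qed.

(** Tonelli for two factors moves s first past x, then past y. Reassociating the product as [g']
    makes the inner integral over y a section integral, hence measurable in (s, x). *)
Lemma fubini_tonelli3 (R : realType) (d1 d2 : measure_display)
    (S : measurableType d1) (T : measurableType d2)
    (lam : {sigma_finite_measure set S -> \bar R})
    (mu : {sigma_finite_measure set T -> \bar R}) (g : S * (T * T) -> \bar R) :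
  measurable_fun setT g -> (forall p, 0 <= g p)%E ->
  (\int[lam]_s \int[mu]_x \int[mu]_y g (s, (x, y)) =
   \int[mu]_x \int[mu]_y \int[lam]_s g (s, (x, y)))%E.
Proof.
move=> mg g0; pose g' (p : S * T * T) := g (p.1.1, (p.1.2, p.2)).
have mg' : measurable_fun setT g'.
  apply: (measurableT_comp mg); apply: measurable_fun_pair => /=.
    by apply: (measurableT_comp measurable_fst); exact: measurable_fst.
  apply: measurable_fun_pair => //.
  by apply: (measurableT_comp measurable_snd); exact: measurable_fst.
have mF : measurable_fun setT (fubini_F mu g').
  by apply: measurable_fun_fubini_tonelli_F => // p; exact: g0.
transitivity (\int[mu]_x \int[lam]_s fubini_F mu g' (s, x))%E.
  rewrite -(fubini_tonelli (fubini_F mu g'))// => p.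
  by apply: integral_ge0 => y _; exact: g0.
apply: eq_integral => x _; rewrite /fubini_F/=.
apply: (fubini_tonelli (fun p : S * T => g (p.1, (x, p.2)))) => //.
apply: (measurableT_comp mg); apply: measurable_fun_pair => //.
exact: measurable_fun_pair.
Qed.

(** * Averaging the flux over blocks of radii, on an abstract measure space *)

Section averaged_flux.
Context (R : realType) (disp : measure_display) (T : measurableType disp).
Variables (mu : {sigma_finite_measure set T -> \bar R}) (r w : T -> R) (q : R).
Hypotheses (mr : measurable_fun setT r) (mw : measurable_fun setT w).
Hypotheses (w_ge0 : forall x, 0 <= w x) (wr : forall x, w x = 0 \/ 0 < r x).
Hypothesis q_ge1 : 1 <= q.

(** The integrand of the moment condition: it dominates both the total mass, through [q_ge1], and
    the tails of r^q. *)
Let majorant x := w x * (if r x < 1 then r x else r x `^ q).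
Hypothesis majorant_fin : (\int[mu]_x (majorant x)%:E < +oo)%E.

(** With [mu] the measure F and [w] the density of nu with respect to F, this is the integrand that
    bounds the flux. *)
Let coupling (z : T * T) := w z.1 * w z.2 * (r z.1 * (r z.1 + r z.2) `^ q).
Let mass x := w x * r x.
Let tail N x := w x * (r x `^ q * \1_[set x | N%:R <= r x] x).

Lemma coupling_ge0 z : 0 <= coupling z.
Proof.
rewrite /coupling; have [->|r0] := wr z.1; first by rewrite !mul0r.
by rewrite !mulr_ge0// ?powR_ge0// ltW.
Qed.

Lemma mass_ge0 x : 0 <= mass x.
Proof.
by rewrite /mass; have [->|r0] := wr x; [rewrite mul0r|rewrite mulr_ge0// ltW].
Qed.

Lemma tail_ge0 N x : 0 <= tail N x.
Proof. by rewrite /tail !mulr_ge0 ?powR_ge0. Qed.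

(** Here q >= 1 enters: it gives r <= r^q as soon as r >= 1. *)
Lemma mass_le_majorant x : mass x <= majorant x.
Proof.
rewrite /mass /majorant; apply: ler_wpM2l => //; case: ltP => // r1.
by rewrite -{1}(powRr1 (le_trans ler01 r1)); exact: ler_powR.
Qed.

(** As N >= 1, the tail lives where r >= 1, that is on the branch r^q of the majorant. *)
Lemma tail_le_majorant N x : (0 < N)%N -> tail N x <= majorant x.
Proof.
move=> N0; rewrite /tail /majorant; have [->|r0] := wr x.
  by rewrite !mul0r.
apply: ler_wpM2l => //; rewrite indicE.
case: (boolP (x \in _)) => [/set_mem /= Nr|_]; last first.
  by rewrite mulr0; case: ifP => _; rewrite ?powR_ge0 ?ltW.
rewrite mulr1 ltNge (le_trans _ Nr)//= ?ler1n//.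
Qed.

Lemma measurable_majorant : measurable_fun setT majorant.
Proof.
apply: measurable_funM => //; apply: measurable_fun_ifT => //.
- exact: measurable_fun_ltr.
- exact: (measurableT_comp (measurable_powR _)).
Qed.

Lemma measurable_mass : measurable_fun setT mass.
Proof. exact: measurable_funM. Qed.

Lemma measurable_ge N : measurable [set x | N%:R <= r x].
Proof.
rewrite (_ : mkset _ = setT `&` r @^-1` `[N%:R, +oo[%classic); last first.
  by apply/seteqP; split => [x|x []]; rewrite /= in_itv/= andbT.
exact: mr.
Qed.

Lemma measurable_tail N : measurable_fun setT (tail N).
Proof.
apply: measurable_funM => //; apply: measurable_funM => //.
  exact: (measurableT_comp (measurable_powR _)).
exact/measurable_indicP/measurable_ge.
Qed.

Lemma measurable_coupling : measurable_fun setT coupling.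
Proof.
have m1 : measurable_fun setT (fun z : T * T => r z.1).
  exact: measurableT_comp.
have m2 : measurable_fun setT (fun z : T * T => r z.2).
  exact: measurableT_comp.
apply: measurable_funM.
  by apply: measurable_funM; exact: measurableT_comp.
apply: measurable_funM => //; apply: (measurableT_comp (measurable_powR _)).
exact: measurable_funD.
Qed.

(** The end 2N forces the larger of the two radii above N; the end 4N bounds [r z.1]. *)
Let crossing N (z : T * T) : set R :=
  `[2 * N%:R, 4 * N%:R]%classic `&` `[r z.1, r z.1 + r z.2[%classic.

(** The crossing set has length at most 2N and at most [r y]. The first bound serves when
    [r x <= r y]; the second serves otherwise, together with [r x <= 4N], which costs the extra
    factor 2 in 2^(q+1). *)
Lemma coupling_crossing_le N (z : T * T) : (0 < N)%N ->
  ((coupling z)%:E * lebesgue_measure (crossing N z) <=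
   (2 * N%:R * (2 `^ (q + 1) *
      (mass z.1 * tail N z.2 + tail N z.1 * mass z.2)))%:E)%E.
Proof.
move=> N0; rewrite /crossing; case: z => x y /=.
set L := lebesgue_measure _.
have N0' : 0 < N%:R :> R by rewrite ltr0n.
have rhs0 : 0 <= 2 * N%:R *
    (2 `^ (q + 1) * (mass x * tail N y + tail N x * mass y)).
  apply: mulr_ge0; first exact: mulr_ge0.
  apply: mulr_ge0; first exact: powR_ge0.
  by apply: addr_ge0; apply: mulr_ge0; [exact: mass_ge0|exact: tail_ge0|
                                        exact: tail_ge0|exact: mass_ge0].
have [wx|rx] := wr x.
  by rewrite /coupling /= wx !mul0r mul0e lee_fin.
have [wy|ry] := wr y.
  by rewrite /coupling /= wy mulr0 !mul0r mul0e lee_fin.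
have L1 : (L <= (2 * N%:R)%:E)%E.
  apply: (@le_trans _ _ (lebesgue_measure
    (`[2 * N%:R, 4 * N%:R]%classic : set R))).
    by apply: le_measure; rewrite ?inE//=; exact: measurableI.
  rewrite lebesgue_measure_itv/= lte_fin ltr_pM2r// ltr_nat/= EFinN.
  rewrite -EFinB lee_fin.
  by rewrite -mulrBl ler_pM2r// lerBlDr -natrD.
have L2 : (L <= (r y)%:E)%E.
  apply: (@le_trans _ _ (lebesgue_measure (`[r x, r x + r y[%classic : set R))).
    by apply: le_measure; rewrite ?inE//=; exact: measurableI.
  by rewrite lebesgue_measure_itv/= lte_fin ltrDl ry EFinN -EFinB addrC addKr.
(* An empty crossing makes the left side vanish; otherwise a radius s in it supplies the
   inequalities used below. *)
have [/seteqP[crossing0 _]|/set0P[s []]] :=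
    eqVneq (`[2 * N%:R, 4 * N%:R]%classic `&`
    `[r x, r x + r y[%classic : set R) set0.
  rewrite /L (_ : _ `&` _ = set0) ?measure0 ?mule0 ?lee_fin//.
  by apply/seteqP; split.
rewrite /= !in_itv/= => /andP[s2N s4N] /andP[rxs sxy].
have q0 : 0 <= q by rewrite (le_trans _ q_ge1).
(* To be applied with c the larger of [r x] and [r y]. *)
have powD (c : R) : 0 <= c -> r x + r y <= 2 * c ->
    (r x + r y) `^ q <= 2 `^ q * c `^ q.
  move=> c0 le2c; rewrite -powRM//; apply: ge0_ler_powR => //.
  - by rewrite nnegrE addr_ge0// ltW.
  - by rewrite nnegrE mulr_ge0.
have two_pow : 2 `^ (q + 1) = 2 * 2 `^ q :> R.
  rewrite powRD; last by apply/implyP => _; rewrite pnatr_eq0.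
  by rewrite powRr1// mulrC.
(* Since r x <= s < r x + r y with 2N <= s, the larger of r x and r y is at
   least N. Its power gives the tail factor; if it is r x, the length r y of the
   crossing interval supplies the mass factor of y. *)
have [xy|yx] := leP (r x) (r y).
  apply: (@le_trans _ _ ((coupling (x, y))%:E * (2 * N%:R)%:E)%E).
    by rewrite lee_wpmul2l// lee_fin coupling_ge0.
  have Ny : N%:R <= r y by lra.
  have tNy : tail N y = w y * r y `^ q by rewrite /tail indicE mem_set//= mulr1.
  rewrite -EFinM lee_fin mulrC; apply: ler_wpM2l; first by rewrite mulr_ge0.
  apply: (@le_trans _ _ (w x * w y * (r x * (2 `^ q * r y `^ q)))).
    rewrite /coupling/=; apply: ler_wpM2l; first exact: mulr_ge0.
    apply: ler_wpM2l; first exact: ltW.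
    by apply: powD; [exact: ltW|lra].
  (* The two nonnegative products are the slack on the right; given their signs, the claim is linear
     in the monomials. *)
  have : 0 <= 2 `^ q * (mass x * tail N y).
    exact: mulr_ge0 (powR_ge0 _ _) (mulr_ge0 (mass_ge0 _) (tail_ge0 _ _)).
  have : 0 <= 2 `^ q * (tail N x * mass y).
    exact: mulr_ge0 (powR_ge0 _ _) (mulr_ge0 (tail_ge0 _ _) (mass_ge0 _)).
  rewrite two_pow tNy /mass; lra.
apply: (@le_trans _ _ ((coupling (x, y))%:E * (r y)%:E)%E).
  by rewrite lee_wpmul2l// lee_fin coupling_ge0.
have Nx : N%:R <= r x by lra.
have tNx : tail N x = w x * r x `^ q by rewrite /tail indicE mem_set//= mulr1.
rewrite -EFinM lee_fin.
apply: (@le_trans _ _ (w x * w y * ((4 * N%:R) * (2 `^ q * r x `^ q)) * r y)).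
  rewrite /coupling/=; apply: ler_wpM2r; first exact: ltW.
  apply: ler_wpM2l; first exact: mulr_ge0.
  apply: ler_pM => //; [exact: ltW|exact: powR_ge0|lra|].
  by apply: powD; [exact: ltW|lra].
have : 0 <= N%:R * (2 `^ q * (mass x * tail N y)).
  apply: mulr_ge0; first exact: ler0n.
  exact: mulr_ge0 (powR_ge0 _ _) (mulr_ge0 (mass_ge0 _) (tail_ge0 _ _)).
rewrite two_pow tNx /mass; lra.
Qed.

Let crossings N : set (R * (T * T)) := [set p | crossing N p.2 p.1].

Lemma measurable_crossings N : measurable (crossings N).
Proof.
have mr1 : measurable_fun setT (fun p : R * (T * T) => r p.2.1).
  by apply: measurableT_comp => //; exact: measurableT_comp.
have mr2 : measurable_fun setT (fun p : R * (T * T) => r p.2.2).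
  by apply: measurableT_comp => //; exact: measurableT_comp.
pose B (p : R * (T * T)) := [&& 2 * N%:R <= p.1 & p.1 <= 4 * N%:R] &&
  [&& r p.2.1 <= p.1 & p.1 < r p.2.1 + r p.2.2].
have mB : measurable_fun setT B.
  apply: measurable_and; apply: measurable_and;
    do ?exact: measurable_fun_ler; apply: measurable_fun_ltr => //.
  exact: measurable_funD.
have := mB measurableT [set true] I; rewrite setTI.
congr (measurable _); apply/seteqP; split => p;
  rewrite /crossings /crossing/B/= !in_itv/=.
  by move=> /andP.
by move=> [-> ->].
Qed.

(** Each product separates the variables, and the two cross terms contribute equally. *)
Lemma integral_cross_products N :
  (\int[mu]_x \int[mu]_y (mass x * tail N y + tail N x * mass y)%:E =
   2%:E * (\int[mu]_x (mass x)%:E * \int[mu]_x (tail N x)%:E))%E.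
Proof.
pose B := (\int[mu]_x (mass x)%:E)%E; pose I := (\int[mu]_x (tail N x)%:E)%E.
have B0 : (0 <= B)%E by apply: integral_ge0 => x _; rewrite lee_fin mass_ge0.
have I0 : (0 <= I)%E by apply: integral_ge0 => x _; rewrite lee_fin tail_ge0.
have mbE : measurable_fun setT (fun x => (mass x)%:E).
  exact/measurable_EFinP/measurable_mass.
have mtE : measurable_fun setT (fun x => (tail N x)%:E).
  exact/measurable_EFinP/measurable_tail.
transitivity (\int[mu]_x ((mass x)%:E * I + (tail N x)%:E * B))%E.
  apply: eq_integral => x _; under eq_integral do rewrite EFinD !EFinM.
  rewrite ge0_integralD//.
  - congr (_ + _)%E; rewrite ge0_integralZl_EFin ?mass_ge0 ?tail_ge0// => y _;
      by rewrite lee_fin ?mass_ge0 ?tail_ge0.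
  - by move=> y _; rewrite mule_ge0// lee_fin ?mass_ge0 ?tail_ge0.
  - exact: measurable_funeM.
  - by move=> y _; rewrite mule_ge0// lee_fin ?mass_ge0 ?tail_ge0.
  - exact: measurable_funeM.
rewrite ge0_integralD//.
- rewrite !ge0_integralZr//; try by move=> x _;
    rewrite lee_fin ?mass_ge0 ?tail_ge0.
  by rewrite -/B -/I [X in (_ + X)%E]muleC -mule2n mule_natl.
- by move=> x _; rewrite mule_ge0// lee_fin mass_ge0.
- by apply: emeasurable_funM => //; exact: measurable_cst.
- by move=> x _; rewrite mule_ge0// lee_fin tail_ge0.
- by apply: emeasurable_funM => //; exact: measurable_cst.
Qed.

(** The lower bound is integrated over s in [2N, 4N], and the order of integration is exchanged so
    that s is innermost. The block length 2N appears on both sides and cancels. *)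
Lemma flux_average_le N (a : R) : (0 < N)%N -> 0 <= a ->
  (forall s, 0 < s -> (a%:E <= \int[mu]_x \int[mu]_y
     (coupling (x, y) *
      \1_[set z | r z.1 <= s < r z.1 + r z.2] (x, y))%:E)%E) ->
  (a%:E <= (2 * 2 `^ (q + 1))%:E *
           (\int[mu]_x (mass x)%:E * \int[mu]_x (tail N x)%:E))%E.
Proof.
move=> N0 a0 flux_ge.
have N0' : 0 < N%:R :> R by rewrite ltr0n.
(* [crossings] includes the restriction of s to the block, so that Tonelli applies over the whole
   line. *)
pose g (p : R * (T * T)) : \bar R := (coupling p.2 * \1_(crossings N) p)%:E.
have mg : measurable_fun setT g.
  apply/measurable_EFinP; apply: measurable_funM.
    apply: measurableT_comp; last exact: measurable_snd.
    exact: measurable_coupling.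
  by apply/measurable_indicP; exact: measurable_crossings.
have g0 p : (0 <= g p)%E by rewrite lee_fin mulr_ge0 ?coupling_ge0.
pose block : set R := `[2 * N%:R, 4 * N%:R]%classic.
have block_length : lebesgue_measure block = (2 * N%:R)%:E.
  rewrite /block lebesgue_measure_itv/= lte_fin ltr_pM2r// ltr_nat/=.
  by rewrite -EFinD -mulrBl; congr (_ * _)%:E; lra.
have lower : ((2 * N%:R * a)%:E <=
    \int[lebesgue_measure]_s \int[mu]_x \int[mu]_y g (s, (x, y)))%E.
  rewrite (_ : (2 * N%:R * a)%:E =
    (\int[lebesgue_measure]_(s in block) a%:E)%E); last first.
    rewrite integral_cst; last exact: measurable_itv.
    transitivity (a%:E * (2 * N%:R)%:E)%E; first by rewrite -EFinM mulrC.
    by congr (_ * _)%E.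
  apply: ge0_le_integral_unmeasurable => //.
  - by move=> s _; apply: integral_ge0 => x _; exact: integral_ge0.
  - move=> s; rewrite /block /= in_itv/= => /andP[s1 s2].
    have s0 : 0 < s by rewrite (lt_le_trans _ s1)// mulr_gt0.
    apply: (le_trans (flux_ge s s0)).
    apply: ge0_le_integral_unmeasurable => //.
    - move=> x _; apply: integral_ge0 => y _.
      by rewrite lee_fin mulr_ge0 ?coupling_ge0.
    - by move=> x _; apply: integral_ge0.
    - move=> x _; apply: ge0_le_integral_unmeasurable => // [y _|y _].
        by rewrite lee_fin mulr_ge0 ?coupling_ge0.
      rewrite lee_fin ler_wpM2l ?coupling_ge0// !indicE.
      case: (boolP (_ \in [set _ | _])) => [/set_mem /= xsy|_]; last by [].
      by rewrite mem_set// /crossings /crossing/= !in_itv/= s1 s2.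
have upper : (\int[lebesgue_measure]_s \int[mu]_x \int[mu]_y g (s, (x, y)) <=
    (2 * N%:R * 2 `^ (q + 1))%:E *
      (2%:E * (\int[mu]_x (mass x)%:E * \int[mu]_x (tail N x)%:E)))%E.
  rewrite (@fubini_tonelli3 _ _ _ (measurableTypeR R) T lebesgue_measure mu
    g mg g0) -integral_cross_products.
  have C0 : 0 <= 2 * N%:R * 2 `^ (q + 1) :> R.
    by rewrite mulr_ge0 ?powR_ge0// mulr_ge0.
  have cross0 x y : 0 <= mass x * tail N y + tail N x * mass y.
    by rewrite addr_ge0// mulr_ge0 ?mass_ge0 ?tail_ge0.
  have mcross : measurable_fun setT
      (fun z : T * T => (mass z.1 * tail N z.2 + tail N z.1 * mass z.2)%:E).
    apply/measurable_EFinP; apply: measurable_funD; apply: measurable_funM;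
      apply: measurableT_comp => //;
      do ?[exact: measurable_mass|exact: measurable_tail].
  rewrite -ge0_integralZl//; last 2 first.
  - have : measurable_fun setT (fubini_F mu
        (fun z : T * T => (mass z.1 * tail N z.2 + tail N z.1 * mass z.2)%:E)).
      by apply: measurable_fun_fubini_tonelli_F => // z; rewrite lee_fin.
    exact.
  - by move=> x _; apply: integral_ge0 => y _; rewrite lee_fin.
  apply: ge0_le_integral_unmeasurable => //.
  - by move=> x _; apply: integral_ge0 => y _; exact: integral_ge0.
  - move=> x _; rewrite mule_ge0 ?lee_fin//.
    by apply: integral_ge0 => y _; rewrite lee_fin.
  - move=> x _; rewrite -ge0_integralZl//; last 2 first.
    + apply/measurable_EFinP; apply: measurable_funD;
        by apply: measurable_funM => //;
          do ?[exact: measurable_mass|exact: measurable_tail].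
    + by move=> y _; rewrite lee_fin.
    apply: ge0_le_integral_unmeasurable => //.
    + by move=> y _; exact: integral_ge0.
    + by move=> y _; rewrite mule_ge0 ?lee_fin.
    (* The innermost integral over s is the coupling times the length of the crossing set. *)
    + move=> y _; rewrite -EFinM -(mulrA (2 * N%:R)).
      apply: (le_trans _ (@coupling_crossing_le N (x, y) N0)).
      have mcrossing : measurable (crossing N (x, y)) by exact: measurableI.
      rewrite (_ : (fun s => g _) = (fun s =>
          (coupling (x, y))%:E * (\1_(crossing N (x, y)) s)%:E)%E); last first.
        by apply/funext => s; rewrite /g EFinM.
      rewrite ge0_integralZl_EFin ?coupling_ge0//.
      * by rewrite integral_indic ?setIT.
      * exact/measurable_EFinP/measurable_indicP.
have N2 : (0 < (2 * N%:R : R)%:E)%E by rewrite lte_fin; exact: mulr_gt0.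
rewrite -(@lee_pmul2l _ (2 * N%:R)%:E isT N2).
rewrite -EFinM (le_trans lower)// (le_trans upper)//.
rewrite !muleA -!EFinM (_ : 2 * N%:R * 2 `^ (q + 1) * 2 =
  2 * N%:R * (2 * 2 `^ (q + 1)))//.
by rewrite -[LHS]mulrA (mulrC _ 2).
Qed.

(** Dominated convergence under [majorant]; the shift to [N.+1] provides the positivity required by
    [tail_le_majorant]. *)
Lemma cvg_tail_integral :
  (fun N => \int[mu]_x (tail N.+1 x)%:E)%E @ \oo --> 0%E.
Proof.
have H0 x : 0 <= majorant x.
  by apply: le_trans (mass_le_majorant x); exact: mass_ge0.
have [] := @dominated_convergence _ _ _ mu setT measurableT
  (fun N x => (tail N.+1 x)%:E) (cst 0%E) (EFin \o majorant).
- by move=> n; apply/measurable_EFinP; exact: measurable_tail.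
- by [].
- apply: aeW => x _; apply: cvg_near_cst.
  (* From this index on, r x < n + 1, so the tail is already zero at x. *)
  exists (Num.truncn (r x)) => // n /=; rewrite truncn_le_nat => rn.
  by rewrite /tail indicE memNset ?mulr0//= leNgt rn.
- apply/integrableP; split; first exact/measurable_EFinP/measurable_majorant.
  by under eq_integral do rewrite /= ger0_norm//.
- apply: aeW => x n _ /=; rewrite lee_fin ger0_norm ?tail_ge0//.
  exact: tail_le_majorant.
by move=> _ _; rewrite integral0.
Qed.

(** The averaged bound holds for every N.+1. Since the mass integral is finite, its product with the
    vanishing tail tends to 0. *)
Lemma flux_lower_bound_le0 (a : R) : 0 <= a ->
  (forall s, 0 < s -> (a%:E <= \int[mu]_x \int[mu]_y
     (coupling (x, y) *
      \1_[set z | r z.1 <= s < r z.1 + r z.2] (x, y))%:E)%E) ->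
  a <= 0.
Proof.
move=> a0 flux_ge; rewrite -lee_fin.
have mass_fin : (\int[mu]_x (mass x)%:E)%E \is a fin_num.
  rewrite ge0_fin_numE; last first.
    by apply: integral_ge0 => x _; rewrite lee_fin mass_ge0.
  apply: le_lt_trans majorant_fin.
  apply: ge0_le_integral_unmeasurable => // x _.
  - by rewrite lee_fin mass_ge0.
  - by rewrite lee_fin (le_trans (mass_ge0 x))// mass_le_majorant.
  - by rewrite lee_fin mass_le_majorant.
pose u N := ((2 * 2 `^ (q + 1))%:E *
  (\int[mu]_x (mass x)%:E * \int[mu]_x (tail N.+1 x)%:E))%E.
have u0 : u @ \oo --> 0%E.
  rewrite -[X in _ --> X](mule0 (2 * 2 `^ (q + 1))%:E); apply: cvgeZl => //.
  rewrite -[X in _ --> X](mule0 (\int[mu]_x (mass x)%:E)%E).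
  apply: cvgeZl => //.
  exact: cvg_tail_integral.
have limu : limn u = 0%E by apply/cvg_lim => //.
apply: (@le_trans _ _ (limn u)); last by rewrite limu.
apply: lime_ge; first by apply/cvg_ex; exists 0%E.
by apply: nearW => N; exact: flux_average_le.
Qed.

End averaged_flux.

(** * Polar coordinates: sigma-finiteness, kernel profile and moments *)

(** By Markov's inequality each set where h >= 1/(n+1) has finite measure. These sets cover D, and
    adding the null complement of D to each of them covers the space. *)
Lemma sigma_finite_of_integral_lty (R : realType) (disp : measure_display)
    (T : measurableType disp) (mu : {measure set T -> \bar R}) (D : set T)
    (h : T -> R) :
  measurable D -> mu (~` D) = 0%E -> measurable_fun setT h ->
  (forall x, 0 <= h x) -> (forall x, D x -> 0 < h x) ->
  (\int[mu]_x (h x)%:E < +oo)%E -> sigma_finite setT mu.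
Proof.
move=> mD muD mh h0 hD hfin; pose F n := [set x | n.+1%:R^-1 <= h x].
have mF n : measurable (F n).
  rewrite (_ : F n = setT `&` h @^-1` `[n.+1%:R^-1, +oo[%classic); last first.
    by apply/seteqP; split => [x|x []]; rewrite /F/= in_itv/= andbT.
  exact: mh.
exists (fun n => ~` D `|` F n).
  apply/esym/seteqP; split => // x _.
  have [Dx|] := pselect (D x); last by exists 0%N => //; left.
  exists (Num.truncn (h x)^-1) => //; right; rewrite /F/=.
  rewrite invf_ple ?posrE ?hD ?ltr0n//.
  by rewrite ltW// truncnS_gt.
move=> n; split; first by apply: measurableU => //; exact: measurableC.
rewrite /=; apply: (le_lt_trans (measureU2 mu (measurableC mD) (mF n))).
rewrite [X in (X + _)%E](_ : _ = 0%E) ?add0e; last exact: muD.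
have : (n.+1%:R^-1%:E * mu (F n) < +oo)%E.
  rewrite -integral_cst//; apply: le_lt_trans hfin.
  by apply: ge0_le_integral_unmeasurable => // x _; rewrite ?lee_fin ?h0.
rewrite !ltey; apply: contra => /eqP ->.
by rewrite gt0_muley// lte_fin invr_gt0.
Qed.

(** The two denominators in [Phi] contribute the extra power 2p of x + y. Through exp and ln this is
    a linear identity between exponents. *)
Lemma kernel_profileE (R : realType) (gam p x y : R) : 0 < x -> 0 < y ->
  (x + y) `^ gam * Phi p (x / (x + y)) =
  (x + y) `^ (gam + 2 * p) * (x `^ (- p) * y `^ (- p)).
Proof.
move=> x0 y0; have s0 : 0 < x + y by exact: addr_gt0.
rewrite /Phi; have -> : 1 - x / (x + y) = y / (x + y) by field; rewrite gt_eqF.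
have xs0 : 0 < x / (x + y) by exact: divr_gt0.
have ys0 : 0 < y / (x + y) by exact: divr_gt0.
rewrite /powR !gt_eqF// -!expRD !ln_div ?posrE//; congr expR; ring.
Qed.

Lemma l1normZ (R : realType) (d : nat) (a : R) (x : 'rV[R]_d) :
  l1norm (a *: x) = `|a| * l1norm x.
Proof.
by rewrite /l1norm mulr_sumr; apply: eq_bigr => j _; rewrite mxE normrM.
Qed.

Section polar_flux.
Context (R : realType) (d : nat) (gam p c : R).
Variable f : {measure set (borelRd R d) -> \bar R}.
Hypothesis d_ge1 : (1 <= d)%N.
Local Notation D := (polar_space R d).
Local Notation PS := (measurableTypeR R * borelRd R d)%type.
Local Notation q := (gam + 2 * p).

(* The density r^(d-1-p) of the header, scaled by sqrt c so that the constant c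
   of the kernel bound is absorbed in the product of two weights. *)
Definition polar_weight (u : PS) : R :=
  Num.sqrt c * (u.1 ^+ d.-1 * u.1 `^ (- p)) * \1_D u.
Local Notation w := polar_weight.

Lemma polar_weight_ge0 u : 0 <= w u.
Proof.
rewrite /w indicE; case: (boolP (u \in D)) => [/set_mem [u0 _]|_].
  by rewrite mulr1 mulr_ge0 ?sqrtr_ge0// mulr_ge0 ?powR_ge0// exprn_ge0// ltW.
by rewrite mulr0.
Qed.

Lemma measurable_polar_weight : measurable_fun setT w.
Proof.
apply: measurable_funM; last first.
  by apply/measurable_indicP; exact: measurable_polar_space.
apply: measurable_funM => //; apply: measurable_funM.
  by apply: measurable_funX; exact: measurable_fst.
apply: (measurableT_comp (measurable_powR _)); exact: measurable_fst.
Qed.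

Lemma measurable_Rdstar : measurable (Rdstar R d : set (borelRd R d)).
Proof.
rewrite -polar_preimage -[X in measurable X]setTI.
by apply: measurable_polar => //; exact: measurable_polar_space.
Qed.

Lemma polar_measure_setC :
  f (~` Rdstar R d) = 0%E -> polar_measure f (~` D) = 0%E.
Proof.
move=> f0; rewrite /polar_measure /pushforward -preimage_setC polar_preimage.
apply: null_set_integral => //.
- by apply: measurableC; exact: measurable_Rdstar.
- apply/measurable_funTS/measurable_EFinP; apply: measurable_funM => //.
  by apply: (measurableT_comp (measurable_powR _)); exact: measurable_l1norm.
Qed.

(** Returning to f absorbs the factor r^(d-1). Up to a constant there remains r^(1-p) for r < 1 and
    r^(q-p) = r^(gam+p) for r >= 1, the two integrands of the moment condition. *)
Lemma polar_moment_lty :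
  (\int[f]_(x in Rdstar R d `&` [set x | (1 <= l1norm x)%R])
          (l1norm x `^ (gam + p))%:E +
       \int[f]_(x in Rdstar R d `&` [set x | (l1norm x < 1)%R])
          (l1norm x `^ (1 - p))%:E < +oo)%E ->
  (\int[polar_measure f]_u
     (w u * (if u.1 < 1 then u.1 else u.1 `^ q))%:E < +oo)%E.
Proof.
move=> moment_fin.
have mRdstar : measurable (Rdstar R d : set (borelRd R d)).
  exact: measurable_Rdstar.
pose hh (y : R) := if y < 1 then y else y `^ q.
(* The factor sqrt d compensates the 1 / sqrt d in [polar_measureP]; sqrt c comes from the
   weight. *)
pose C := Num.sqrt d%:R * Num.sqrt c.
pose psi (u : PS) : R := C * (u.1 `^ (- p) * hh u.1).
have C0 : 0 <= C by rewrite mulr_ge0 ?sqrtr_ge0.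
have mhh : measurable_fun setT hh.
  by apply: measurable_fun_ifT => //; exact: measurable_fun_ltr.
have mphh : measurable_fun setT (fun y => y `^ (- p) * hh y).
  by apply: measurable_funM => //; exact: (measurable_powR _).
have mpsi : measurable_fun D psi.
  apply: measurable_funTS; apply: measurable_funM => //.
  by apply: (measurableT_comp mphh); exact: measurable_fst.
rewrite (_ : (\int[_]_u _)%E = \int[polar_measure f]_(u in D)
    (psi u * (u.1 ^+ d.-1 / Num.sqrt d%:R))%:E)%E; last first.
  rewrite [RHS]integral_mkcond; apply: eq_integral => u _.
  rewrite /patch /w indicE; case: (u \in D); last by rewrite mulr0 mul0r.
  rewrite mulr1 -/(hh u.1) /psi /C; congr EFin.
  by field; rewrite gt_eqF// sqrtr_gt0 ltr0n.
rewrite polar_measureP// /psi/=.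
under eq_integral do rewrite EFinM.
rewrite ge0_integralZl_EFin//; last 2 first.
- move=> x _; rewrite lee_fin mulr_ge0 ?powR_ge0// /hh.
  by case: ifPn => _; rewrite ?powR_ge0// sumr_ge0.
- apply/measurable_EFinP/measurable_funTS; apply: (measurableT_comp mphh).
  exact: measurable_l1norm.
apply: lte_mul_pinfty => //.
apply: le_lt_trans moment_fin.
set A := _ `&` _; set B := _ `&` _.
have mge1 : measurable [set x : borelRd R d | 1 <= l1norm x].
  rewrite (_ : mkset _ = setT `&` @l1norm R d @^-1` `[1, +oo[%classic).
    exact: measurable_l1norm.
  by apply/seteqP; split => [x|x []]; rewrite /= in_itv/= andbT.
have mlt1 : measurable [set x : borelRd R d | l1norm x < 1].
  rewrite (_ : mkset _ = setT `&` @l1norm R d @^-1` `]-oo, 1[%classic).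
    exact: measurable_l1norm.
  by apply/seteqP; split => [x|x []]; rewrite /= in_itv/=.
have mA : measurable (A : set (borelRd R d)).
  exact: measurableI.
have mB : measurable (B : set (borelRd R d)).
  exact: measurableI.
have -> : Rdstar R d = A `|` B.
  apply/seteqP; split => [x Rx|x [[]|[]]//].
  by have [|] := leP 1 (l1norm x); [left|right].
have l1norm_gt0 x : Rdstar R d x -> 0 < l1norm x.
  by move=> [_ x0]; rewrite lt_def l1norm_eq0 x0 sumr_ge0.
rewrite ge0_integral_setU//; last 3 first.
- apply/measurable_EFinP/measurable_funTS; apply: (measurableT_comp mphh).
  exact: measurable_l1norm.
- move=> x _; rewrite lee_fin mulr_ge0 ?powR_ge0// /hh.
  by case: ifPn => _; rewrite ?powR_ge0// sumr_ge0.
- apply/disj_setPS => x [[_ /= x1] [_ /=]].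
  by rewrite ltNge x1.
rewrite le_eqVlt; apply/orP; left; apply/eqP; congr (_ + _)%E;
  apply: eq_integral => x /set_mem[/l1norm_gt0 x0 /= x1]; congr EFin;
  rewrite /hh.
  rewrite ltNge x1/= -powRD; first by congr (_ `^ _); ring.
  by apply/implyP => _; rewrite gt_eqF.
rewrite x1 -{2}(powRr1 (ltW x0)) -powRD; first by rewrite addrC.
by apply/implyP => _; rewrite gt_eqF.
Qed.

End polar_flux.

(** * Nonexistence: reduction to the abstract flux bound *)

Theorem theorem3p6 (R : realType) (d : nat) (gam p c1 c2 : R)
    (K : 'rV[R]_d -> 'rV[R]_d -> R)
    (d_ge1 : (1 <= d)%N)
    (gam_p : 1 <= gam + 2 * p)
    (c1_gt0 : 0 < c1) (c1_le_c2 : c1 <= c2)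
    (K_ge0 : forall x y : 'rV[R]_d,
       Rdstar R d x -> Rdstar R d y -> 0 <= K x y)
    (K_continuous : {within Rdstar R d `*` Rdstar R d,
       continuous (fun z : 'rV[R]_d * 'rV[R]_d => K z.1 z.2)})
    (K_bounds : forall x y : 'rV[R]_d, Rdstar R d x -> Rdstar R d y ->
       c1 * (l1norm x + l1norm y) `^ gam
          * Phi p (l1norm x / (l1norm x + l1norm y)) <= K x y /\
       K x y <= c2 * (l1norm x + l1norm y) `^ gam
          * Phi p (l1norm x / (l1norm x + l1norm y))) :
  ~ exists f : {measure set (borelRd R d) -> \bar R},
      nontrivial_constant_flux_solution K gam p f.
Proof.
move=> [f [[[f_null _ _] moment_fin _] [J0 [[J0_ge0 J0_neq0] fluxE]]]].
have c2_gt0 : 0 < c2 by exact: lt_le_trans c1_le_c2.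
have [j J0j] : exists j, 0 < J0 ord0 j.
  apply: contrapT => noj; move/negP: J0_neq0; apply; apply/eqP/rowP => j.
  rewrite mxE; apply/eqP; rewrite eq_le J0_ge0 andbT leNgt; apply/negP => ?.
  by apply: noj; exists j.
pose w := @polar_weight R d p c2.
pose q := gam + 2 * p.
have w_gt0 u : polar_space R d u -> 0 < w u.
  move=> Du; rewrite /w /polar_weight indicE mem_set// mulr1.
  case: Du => u0 _; rewrite mulr_gt0 ?sqrtr_gt0// mulr_gt0 ?powR_gt0//.
  exact: exprn_gt0.
have h_gt0 u : polar_space R d u ->
    0 < w u * (if u.1 < 1 then u.1 else u.1 `^ q).
  move=> Du; rewrite mulr_gt0 ?w_gt0//; case: Du => u0 _.
  by case: ifPn; rewrite ?powR_gt0.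
have w_out u : ~ polar_space R d u -> w u = 0.
  by move=> nDu; rewrite /w /polar_weight indicE memNset// mulr0.
have mh : measurable_fun setT
    (fun u => w u * (if u.1 < 1 then u.1 else u.1 `^ q)).
  apply: measurable_funM; first exact: measurable_polar_weight.
  apply: measurable_fun_ifT.
  - by apply: measurable_fun_ltr => //; exact: measurable_fst.
  - exact: measurable_fst.
  - by apply: (measurableT_comp (measurable_powR _)); exact: measurable_fst.
have h_ge0 u : 0 <= w u * (if u.1 < 1 then u.1 else u.1 `^ q).
  have [/h_gt0/ltW//|/w_out ->] := pselect (polar_space R d u).
  by rewrite mul0r.
have h_fin := @polar_moment_lty R d gam p c2 f d_ge1 moment_fin.
(* Tonelli needs this; the moment integrand is positive on the polar domain and has a finite
   integral. *)
have F_sfin : sigma_finite setT (polar_measure f).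
  apply: (sigma_finite_of_integral_lty _ _ mh h_ge0 h_gt0 h_fin).
    exact: measurable_polar_space.
  exact: polar_measure_setC.
pose F : {sigma_finite_measure set _ -> \bar R} := HB.pack (polar_measure f)
  (Measure_isSigmaFinite.Build _ _ _ (polar_measure f) F_sfin).
(* The factor d undoes the 1/d in [flux], leaving the bare double integral. *)
suff : d%:R * J0 ord0 j <= 0 by rewrite leNgt mulr_gt0// ltr0n.
apply: (@flux_lower_bound_le0 R _ _ F fst w q) => //.
- exact: measurable_polar_weight.
- by move=> u; exact: polar_weight_ge0.
- move=> u; have [[u0 _]|/w_out] := pselect (polar_space R d u); first by right.
  by left.
- by rewrite mulr_ge0.
move=> s s0.
have := fluxE s j s0; rewrite /flux.
set I := (X in (_ * X)%E) => fluxI.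
have -> : (d%:R * J0 ord0 j)%:E = I.
  by rewrite EFinM -fluxI muleA -EFinM divff ?mul1e// pnatr_eq0 -lt0n.
rewrite {fluxI}/I.
have polar_Rdstar u : polar_space R d u ->
    Rdstar R d (u.1 *: (u.2 : 'rV[R]_d)) /\
    l1norm (u.1 *: (u.2 : 'rV[R]_d)) = u.1.
  move=> [u0 [[u2_ge0 u2_neq0] u2_1]]; split; last first.
    by rewrite l1normZ u2_1 mulr1 gtr0_norm.
  split=> [i|]; first by rewrite mxE mulr_ge0// ltW.
  by rewrite scaler_eq0 negb_or u2_neq0 gt_eqF.
have simplex_coord (x : 'rV[R]_d) : simplex R d x -> 0 <= x ord0 j <= 1.
  move=> [[x_ge0 _] <-]; rewrite x_ge0/= /l1norm (bigD1 j)//=.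
  by rewrite ger0_norm ?lerDl ?sumr_ge0.
have inA (u : measurableTypeR R * borelRd R d) :
    (`]0, s]%classic `*` simplex R d) u ->
    polar_space R d u /\ u.1 <= s.
  by move=> [/=]; rewrite in_itv/= => /andP[u0 us] ?.
have inB (u v : measurableTypeR R * borelRd R d) :
    u.1 <= s -> (`](s - u.1), +oo[%classic `*` simplex R d) v ->
    polar_space R d v /\ s < u.1 + v.1.
  move=> us [/=]; rewrite in_itv/= andbT => sv ?; split; last by lra.
  by split => //; lra.
have integrand_ge0 (u v : measurableTypeR R * borelRd R d) :
    polar_space R d u -> polar_space R d v ->
    0 <= u.1 ^+ d * v.1 ^+ d.-1 * (u.2 : 'rV[R]_d) ord0 j *
      K (u.1 *: (u.2 : 'rV[R]_d)) (v.1 *: (v.2 : 'rV[R]_d)).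
  move=> Du Dv.
  have [Ru _] := polar_Rdstar _ Du; have [Rv _] := polar_Rdstar _ Dv.
  apply: mulr_ge0; last exact: K_ge0.
  case: Du => u0 /simplex_coord/andP[u2_ge0 _]; case: Dv => v0 _.
  by rewrite !mulr_ge0// exprn_ge0// ltW.
(* Bound theta_j by 1 and K by its upper bound, write r^d = r * r^(d-1), and split c2 as the square
   of sqrt c2 between the two weights. *)
have integrand_le (u v : measurableTypeR R * borelRd R d) :
    polar_space R d u -> polar_space R d v ->
    u.1 ^+ d * v.1 ^+ d.-1 * (u.2 : 'rV[R]_d) ord0 j *
      K (u.1 *: (u.2 : 'rV[R]_d)) (v.1 *: (v.2 : 'rV[R]_d)) <=
    w u * w v * (u.1 * (u.1 + v.1) `^ q).
  move=> Du Dv.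
  have [Ru nu] := polar_Rdstar _ Du; have [Rv nv] := polar_Rdstar _ Dv.
  have := (K_bounds _ _ Ru Rv).2; rewrite nu nv -mulrA => K_le.
  have -> : w u * w v * (u.1 * (u.1 + v.1) `^ q) = u.1 ^+ d * v.1 ^+ d.-1 * 1 *
      (c2 * ((u.1 + v.1) `^ gam * Phi p (u.1 / (u.1 + v.1)))).
    rewrite /w /polar_weight !indicE !mem_set// kernel_profileE; last 2 first.
    - by case: Du.
    - by case: Dv.
    have -> : u.1 ^+ d = u.1 * u.1 ^+ d.-1 by rewrite -exprS prednK.
    rewrite -[in RHS](sqr_sqrtr (ltW c2_gt0)) /q !mulr1.
    by ring.
  case: Du => u0 /simplex_coord/andP[u2_ge0 u2_le1]; case: Dv => v0 _.
  have powers_ge0 : 0 <= u.1 ^+ d * v.1 ^+ d.-1.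
    by rewrite mulr_ge0// exprn_ge0// ltW.
  apply: ler_pM; [exact: mulr_ge0|exact: K_ge0|exact: ler_wpM2l|exact: K_le].
have w_ge0 u : 0 <= w u by exact: polar_weight_ge0.
have k_ge0 (u v : measurableTypeR R * borelRd R d) :
    0 <= w u * w v * (u.1 * (u.1 + v.1) `^ q).
  have [[u0 _]|/w_out->] := pselect (polar_space R d u); last by rewrite !mul0r.
  by apply: mulr_ge0; rewrite mulr_ge0 ?powR_ge0 ?w_ge0 ?ltW.
(* The domains grow to the whole space; the indicator of r <= s < r + r' is 1 on the original
   ones. *)
apply: (@ge0_le_integral_unmeasurable _ _ _ F) => //.
- move=> u /inA[Du us]; apply: integral_ge0 => v /(inB _ _ us)[Dv _].
  by rewrite lee_fin integrand_ge0.
- by move=> u _; apply: integral_ge0 => v _; rewrite lee_fin mulr_ge0 ?k_ge0.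
- move=> u /inA[Du us]; apply: (@ge0_le_integral_unmeasurable _ _ _ F) => //.
  + by move=> v /(inB _ _ us)[Dv _]; rewrite lee_fin integrand_ge0.
  + by move=> v _; rewrite lee_fin mulr_ge0 ?k_ge0.
  + move=> v /(inB _ _ us)[Dv sv]; rewrite lee_fin indicE mem_set/= ?us//.
    by rewrite mulr1; exact: integrand_le.
Qed.
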